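(* Let $G$ be an $n$-vertex PLB graph with parameters $\alpha$ and $t$, where $\alpha<3$, and assume $G$ has PLB neighborhoods. Then algorithm CountTriangles computes the number of triangles in $G$ in time (a) $O(n^{9/2-3\alpha/2}(t+1)^{3\alpha/2-3/2})$ for $2<\alpha<7/3$; (b) $\tilde O(n(t+1)^2)$ for $\alpha\ge 7/3$.
   Context: Graphs are finite, simple, undirected; $n$ is the number of vertices; $\log$ is binary; $\tilde O$ hides polylogarithmic factors in $n$. Fix universal constants $c_1,c_2>0$. An $n$-vertex graph $G$ is power law bounded (PLB) with parameters $\alpha$ and $t$ ($\alpha>1$ a constant, $t\ge0$ real) if for every integer $d\ge0$ the number of vertices $v$ with $\deg(v)\in[2^d,2^{d+1})$ is at most $c_1n(t+1)^{\alpha-1}\sum_{i=2^d}^{2^{d+1}-1}(i+t)^{-\alpha}$. A PLB graph with parameters $\alpha>2$ and $t$ has PLB neighborhoods if for every vertex $v$ of degree $k$, the number of neighbors of $v$ of degree at least $k$ is at most $c_2\max(\log n,(t+1)^{\alpha-2}k\sum_{i=k}^{n-1}i(i+t)^{-\alpha})$. $O(\cdot)$ hides constants depending only on $c_1,c_2,\alpha$. Let $\vec G$ be obtained by sorting vertices in non-decreasing order of degree and orienting each edge towards its later endpoint. Algorithm CountTriangles($G$): build $\vec G$; set a counter to $0$; for each vertex $v$, let $S$ be the set of out-neighbors of $v$ in $\vec G$ (Boolean array); for each in-edge $wv$ of $v$ and each out-edge $wu$ of $w$ in $\vec G$, if $u\in S$ increment the counter; return the counter. *)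

(* Defs.v *)
From HB Require Import structures.
From mathcomp Require Import all_boot all_order all_algebra.
From mathcomp Require Import reals exp.

Set Implicit Arguments.
Unset Strict Implicit.
Unset Printing Implicit Defensive.

Import Order.TTheory GRing.Theory Num.Theory.

Record sgraph := SGraph {
  vertex :> finType;
  edge : rel vertex;
  edge_sym : symmetric edge;
  edge_irr : irreflexive edge }.

Definition deg (G : sgraph) (v : G) : nat := #|[set u | edge v u]|.

Definition triangles (G : sgraph) : {set {set G}} :=
  [set A : {set G} | (#|A| == 3) &&
    [forall x in A, forall y in A, (x != y) ==> edge x y]].

Section PowerLawBounded.

Local Open Scope ring_scope.

Variable R : realType.

Definition log2 (x : R) : R := ln x / ln 2.

Definition PLB (c1 alpha t : R) (G : sgraph) : Prop :=
  [/\ 1 < alpha, 0 <= t &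
    forall d : nat,
      #|[set v : G | 2 ^ d <= deg v < 2 ^ d.+1]%N|%:R <=
        c1 * #|G|%:R * (t + 1) `^ (alpha - 1) *
          \sum_((2 ^ d)%N <= i < (2 ^ d.+1)%N) (i%:R + t) `^ (- alpha)].

Definition PLB_neighborhoods (c1 c2 alpha t : R) (G : sgraph) : Prop :=
  [/\ PLB c1 alpha t G, 2 < alpha &
    forall v : G,
      #|[set u | edge v u && (deg v <= deg u)%N]|%:R <=
        c2 * Num.max (log2 #|G|%:R)
               ((t + 1) `^ (alpha - 2) * (deg v)%:R *
                \sum_(deg v <= i < #|G|) i%:R * (i%:R + t) `^ (- alpha))].

End PowerLawBounded.

(* Unit-cost RAM programs, written in a monad that pairs the result with the
   number of elementary steps. [ret] and [bind] are free, so programs must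
   access data only through the primitives below; they use arrays in a
   single-threaded way, hence [put] stands for a constant-time update in
   place. *)
Definition timed (A : Type) : Type := (A * nat)%type.

Definition ret (A : Type) (x : A) : timed A := (x, 0).

Definition bind (A B : Type) (m : timed A) (k : A -> timed B) : timed B :=
  let r := k m.1 in (r.1, m.2 + r.2).

Notation "'let*' x ':=' m 'in' k" := (bind m (fun x => k))
  (at level 200, x pattern, m at level 100, k at level 200,
   format "'[v' 'let*'  x  ':='  m  'in' '/' k ']'").

(* One operation of the machine: arithmetic, comparison, assignment, or
   adding a cell in front of a linked list. *)
Definition step (A : Type) (x : A) : timed A := (x, 1).

Definition new_array (I : finType) (A : Type) (x : A) :
    timed {ffun I -> A} := ([ffun=> x], #|I|.+1).

Definition get (I : finType) (A : Type) (a : {ffun I -> A}) (i : I) :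
    timed A := (a i, 1).

Definition put (I : finType) (A : Type) (a : {ffun I -> A}) (i : I) (x : A) :
    timed {ffun I -> A} := ([ffun j => if j == i then x else a j], 1).

(* One step per iteration, and one more to leave the loop, on top of the cost
   of the body. *)
Fixpoint foreach (A S : Type) (s : seq A) (st : S)
    (body : A -> S -> timed S) : timed S :=
  match s with
  | [::] => step st
  | x :: s' =>
      let* _ := step tt in
      let* st' := body x st in
      foreach s' st' body
  end.

(* The input: an enumeration of the vertices and an array of adjacency lists,
   both in an arbitrary order. As the order of the vertices is arbitrary, so
   is the way in which the sort by degree breaks ties. *)
Record input (G : sgraph) := Input {
  vertices : seq G;
  adjacency : {ffun G -> seq G};
  verticesP : perm_eq vertices (enum G);
  adjacencyP : forall v : G,
    perm_eq (adjacency v) (enum [set u | edge v u]) }.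

Section CountTriangles.

Variables (G : sgraph) (X : input G).

Definition compute_degrees : timed {ffun G -> nat} :=
  let* dg := new_array G 0 in
  foreach (vertices X) dg (fun v dg =>
    let* l := get (adjacency X) v in
    let* d := step 0 in
    let* d := foreach l d (fun _ d => step d.+1) in
    put dg v d).

(* Bucket sort; the result maps each vertex to its position in the sorted
   order. Degrees are at most [#|G|], so [inord] is only a change of type. *)
Definition sort_by_degree : timed {ffun G -> nat} :=
  let* dg := compute_degrees in
  let* bucket := new_array 'I_(#|G|).+1 ([::] : seq G) in
  let* bucket := foreach (vertices X) bucket (fun v bucket =>
    let* d := get dg v in
    let* l := get bucket (inord d) in
    let* l := step (v :: l) in
    put bucket (inord d) l) in
  let* pos := new_array G 0 in
  let* next := step 0 in
  let* (pos, _) := foreach (enum 'I_(#|G|).+1) (pos, next) (fun d st =>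
    let* l := get bucket d in
    foreach l st (fun v '(pos, next) =>
      let* pos := put pos v next in
      let* next := step next.+1 in
      ret (pos, next))) in
  ret pos.

(* The out-neighbour and in-neighbour lists of the oriented graph. *)
Definition build_orientation :
    timed ({ffun G -> seq G} * {ffun G -> seq G}) :=
  let* pos := sort_by_degree in
  let* out := new_array G ([::] : seq G) in
  let* inn := new_array G ([::] : seq G) in
  foreach (vertices X) (out, inn) (fun v st =>
    let* pv := get pos v in
    let* l := get (adjacency X) v in
    foreach l st (fun u '(out, inn) =>
      let* pu := get pos u in
      let* forward := step (pv < pu) in
      if forward then
        let* lo := get out v in
        let* lo := step (u :: lo) in
        let* out := put out v lo in
        let* li := get inn u in
        let* li := step (v :: li) in
        let* inn := put inn u li in
        ret (out, inn)
      else ret (out, inn))).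

(* The Boolean array [inS] is allocated once; after each vertex it is cleared by
   another pass over the out-neighbours. *)
Definition count_triangles : timed nat :=
  let* (out, inn) := build_orientation in
  let* counter := step 0 in
  let* inS := new_array G false in
  let* (counter, _) := foreach (vertices X) (counter, inS)
    (fun v '(counter, inS) =>
      let* outv := get out v in
      let* inS := foreach outv inS (fun u inS => put inS u true) in
      let* inv := get inn v in
      let* counter := foreach inv counter (fun w counter =>
        let* outw := get out w in
        foreach outw counter (fun u counter =>
          let* b := get inS u in
          if b then step counter.+1 else ret counter)) in
      let* inS := foreach outv inS (fun u inS => put inS u false) in
      ret (counter, inS)) in
  ret counter.

Definition output : nat := count_triangles.1.

Definition running_time : nat := count_triangles.2.

End CountTriangles.

(* Main.v *)
Require Import Defs.
From HB Require Import structures.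
From mathcomp Require Import all_boot all_order all_algebra.
From mathcomp Require Import sequences reals exp.
From mathcomp Require Import zify ring lra.

(* Sorting by degree makes the out-degree of [v] at most the number [h v] of
   neighbors of degree at least [deg v], and the running time is
   O(n + \sum_v h(v)^2). Split the vertices into the dyadic degree classes
   [2^d, 2^(d+1)). On the class of 2^d, PLB neighborhoods give
   h = O(log n + (t+1)^(alpha-2) 2^d (2^d+t)^(2-alpha)), so that apart from the
   logarithmic part the class contributes
   O(n (t+1)^(3 alpha-5) 8^d (2^d+t)^(4-3 alpha)). For alpha >= 7/3 each of the
   O(log n) classes contributes O(n (t+1)^2). For alpha < 7/3 the contributions
   grow geometrically, and they are summed only up to K = sqrt(n (t+1)): there
   are N = O(n (t+1)^(alpha-1) K^(1-alpha)) vertices of degree at least K, for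
   which h <= N, and N^3 is of the same order as the sum below K. *)

Set Implicit Arguments.
Unset Strict Implicit.
Unset Printing Implicit Defensive.

Import Order.TTheory GRing.Theory Num.Theory.

(** * The program *)

Lemma foreach_result (A S : Type) (s : seq A) (st : S) (body : A -> S -> timed S) :
  (foreach s st body).1 = foldl (fun st x => (body x st).1) st s.
Proof. by elim: s st => //= x s IHs st; rewrite IHs. Qed.

Lemma foreach_time (A S : Type) (s : seq A) (st : S)
    (body : A -> S -> timed S) (f : A -> nat) :
  (forall x st, (body x st).2 <= f x) ->
  (foreach s st body).2 <= (\sum_(x <- s) (f x).+1).+1.
Proof.
move=> bodyf; elim: s st => [|x s IHs] st; first by rewrite big_nil.
have := IHs (body x st).1; have := bodyf x st; rewrite big_cons /=; lia.
Qed.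

(** * Loops over arrays as folds in closed form *)

Section Folds.

Variables (I : finType) (A T S : Type).

Lemma foldl_pair (S' : Type) (f : S -> T -> S) (g : S' -> T -> S') a b s :
  foldl (fun st x => (f st.1 x, g st.2 x)) (a, b) s = (foldl f a s, foldl g b s).
Proof. by elim: s a b => //= x s IHs a b; rewrite IHs. Qed.

Lemma foldl_filter (p : pred T) (f : S -> T -> S) a s :
  foldl (fun st x => if p x then f st x else st) a s = foldl f a (filter p s).
Proof. by elim: s a => //= x s IHs a; rewrite IHs; case: (p x). Qed.

Lemma eq_foldl (f g : S -> T -> S) a s : f =2 g -> foldl f a s = foldl g a s.
Proof. by move=> fg; elim: s a => //= x s IHs a; rewrite fg IHs. Qed.

Lemma foldl_flatten (U : Type) (f : S -> T -> S) (g : U -> seq T) a s :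
  foldl (fun st v => foldl f st (g v)) a s = foldl f a (flatten (map g s)).
Proof. by elim: s a => //= v s IHs a; rewrite IHs foldl_cat. Qed.

Lemma foldl_allpairs (U : Type) (f : S -> U * T -> S) (g : U -> seq T) a s :
  foldl (fun st v => foldl (fun st u => f st (v, u)) st (g v)) a s =
  foldl f a [seq (v, u) | v <- s, u <- g v].
Proof.
elim: s a => //= x s IHs a; rewrite IHs foldl_cat; congr foldl.
by elim: (g x) a => //= y l IHl a; rewrite IHl.
Qed.

(** New elements go to the front, so each cell lists its elements in reverse order of their
    arrival. *)
Lemma foldl_push (i : T -> I) (x : T -> A) (b : {ffun I -> seq A}) s j :
  foldl (fun (b : {ffun I -> seq A}) v =>
    [ffun j => if j == i v then x v :: b (i v) else b j]) b s j =
  rev [seq x v | v <- s & i v == j] ++ b j.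
Proof.
elim: s b => //= v s IHs b; rewrite IHs ffunE eq_sym.
by case: eqP => //= ->; rewrite rev_cons cat_rcons.
Qed.

(** The value written depends on the index alone, so repeated writes to one cell agree. *)
Lemma foldl_put (f : I -> A) (a : {ffun I -> A}) s :
  foldl (fun (a : {ffun I -> A}) v => [ffun j => if j == v then f v else a j]) a s =
  [ffun j => if j \in s then f j else a j].
Proof.
elim: s a => /= [|v s IHs] a; first by apply/ffunP => j; rewrite ffunE.
rewrite IHs; apply/ffunP => j; rewrite !ffunE in_cons.
by case: (j \in s); [rewrite orbT | case: eqP => //= ->].
Qed.

Lemma foldl_number (p : {ffun I -> nat}) k s : uniq s ->
  (foldl (fun (st : {ffun I -> nat} * nat) v =>
    ([ffun j => if j == v then st.2 else st.1 j], st.2.+1)) (p, k) s).1 =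
  [ffun j => if j \in s then k + index j s else p j].
Proof.
elim: s p k => /= [|v s IHs] p k; first by move=> _; apply/ffunP => j; rewrite ffunE.
case/andP=> vs us; rewrite IHs //; apply/ffunP => j; rewrite !ffunE in_cons [v == j]eq_sym.
case: eqP => [->|_] /=; first by rewrite (negPf vs) addn0.
by rewrite addnS addSn.
Qed.

End Folds.

(** * Bucket sort *)

(** Both lists are compared by counting with an arbitrary predicate. After the sums over buckets and
    elements are exchanged, each [x] is counted in exactly one bucket, that of [key x]. *)
Lemma perm_bucket (T D : eqType) (key : T -> D) (ds : seq D) (s : seq T) :
  uniq ds -> {in s, forall x, key x \in ds} ->
  perm_eq (flatten [seq rev [seq x <- s | key x == d] | d <- ds]) s.
Proof.
move=> uds sds; apply/permP => a; rewrite count_flatten -map_comp sumnE big_map.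
under eq_bigr => d _ do rewrite /= count_rev count_filter -sum1_count big_mkcond.
rewrite exchange_big -sum1_count [RHS]big_mkcond /= big_seq [RHS]big_seq.
apply: eq_bigr => x xs; rewrite -big_mkcond sum1_count /=.
case: (a x) => /=; last by rewrite count_pred0.
rewrite (eq_count (a2 := pred1 (key x))) => [|d /=]; last exact: eq_sym.
by rewrite count_uniq_mem // sds.
Qed.

(** Keys are constant inside a bucket and increase from one bucket to the next. *)
Lemma sorted_bucket (T : eqType) (key : T -> nat) (n : nat) (s : seq T) :
  sorted (relpre key leq)
    (flatten [seq rev [seq x <- s | key x == d] | d <- iota 0 n]).
Proof.
rewrite sorted_pairwise; last by move=> x y z /=; apply: leq_trans.
elim: n 0 => //= n IHn k; rewrite pairwise_cat IHn andbT; apply/andP; split.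
- apply/allrelP => x y; rewrite mem_rev mem_filter => /andP[/eqP kx _].
  case/flattenP=> l /mapP[d]; rewrite mem_iota => /andP[kd _] -> .
  by rewrite mem_rev mem_filter => /andP[/eqP ky _]; rewrite /= kx ky ltnW.
- have: {in rev [seq x <- s | key x == k], forall x, key x = k}.
    by move=> x; rewrite mem_rev mem_filter => /andP[/eqP].
  elim: (rev _) => //= x l IHl lk; rewrite IHl ?andbT => [|y yl]; last first.
    by apply: lk; rewrite inE yl orbT.
  by apply/allP => y yl /=; rewrite !lk ?mem_head // inE yl orbT.
Qed.

Lemma bind_result (A B : Type) (m : timed A) (k : A -> timed B) :
  (bind m k).1 = (k m.1).1.
Proof. by []. Qed.

(** * Counting triangles along a vertex order *)

(** Each triangle has exactly one listing [w], [v], [u] by increasing rank [r], and the sum counts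
    these listings by their middle vertex [v], as the algorithm does. *)
Lemma card_triangles (G : sgraph) (r : G -> nat) : injective r ->
  #|triangles G| =
  \sum_v \sum_(w | edge w v && (r w < r v))
    #|[pred u | (edge w u && (r w < r u)) && (edge v u && (r v < r u))]|.
Proof.
move=> r_inj.
pose a w v := edge w v && (r w < r v).
pose S : {set G * G * G} :=
  [set p | [&& a p.1.2 p.1.1, a p.1.2 p.2 & a p.1.1 p.2]].
transitivity #|S|; last first.
  rewrite -sum1_card (eq_bigl (fun p : G * G * G =>
    (a p.1.2 p.1.1) && (a p.1.2 p.2 && a p.1.1 p.2))) => [|p]; last by rewrite inE.
  rewrite -(pair_big_dep (fun q : G * G => a q.2 q.1)
    (fun q u => a q.2 u && a q.1 u) (fun _ _ => 1)) /=.
  rewrite -(pair_big_dep xpredT (fun v w => a w v)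
    (fun v w => \sum_(u | a w u && a v u) 1)) /=.
  by apply: eq_bigr => v _; apply: eq_bigr => w _; rewrite sum1_card.
pose f (p : G * G * G) : {set G} := [set p.1.2; p.1.1; p.2].
have neq u v : r u < r v -> u != v.
  by apply: contraTneq => ->; rewrite ltnn.
rewrite -(card_in_imset (f := f) (D := S)); last first.
  move=> [[v w] u] [[v' w'] u']; rewrite !inE /f /= =>
    /and3P[/andP[_ wv] _ /andP[_ vu]] /and3P[/andP[_ wv'] _ /andP[_ vu']] E.
  have mem x : x \in [set w; v; u] -> [|| x == w', x == v' | x == u'].
    by rewrite E !inE orbA.
  (* Of the 27 ways to match [w], [v], [u] with [w'], [v'], [u'], only the identity respects the
     rank inequalities. *)
  have := mem w; have := mem v; have := mem u; rewrite !inE !eqxx /= !orbT.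
  move=> /(_ isT)/or3P[]/eqP ? /(_ isT)/or3P[]/eqP ? /(_ isT)/or3P[]/eqP ?;
    by [subst | exfalso; subst; lia].
apply: eq_card => A; apply/idP/imsetP => [|[[[v w] u]]]; last first.
  rewrite /f !inE /= => /and3P[/andP[wv rwv] /andP[wu rwu] /andP[vu rvu]] ->.
  rewrite -setUA cardsU1 cards2 !inE negb_or !neq //=.
  apply/forall_inP => x; rewrite !inE => xA; apply/forall_inP => y; rewrite !inE.
  have [vw uw uv] : [/\ edge v w, edge u w & edge u v].
    by split; rewrite edge_sym.
  by move: xA => /or3P[]/eqP -> /or3P[]/eqP ->; rewrite ?eqxx // ?wv ?wu ?vu ?vw ?uw ?uv implybT.
rewrite inE => /andP[/eqP A3 /forall_inP Ae].
(* Sorting the three vertices of a triangle by rank gives its preimage in [S]. *)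
pose s := sort (relpre r leq) (enum A).
have ss : sorted (relpre r leq) s by apply: sort_sorted => x y; apply: leq_total.
have us : uniq s by rewrite sort_uniq enum_uniq.
have ms x : (x \in s) = (x \in A) by rewrite mem_sort mem_enum.
have : size s = 3 by rewrite size_sort -cardE.
case: s ss us ms => [|w [|v [|u []]]] //= /and3P[wv vu _].
rewrite !inE !negb_or => /and3P[/andP[wv' wu'] vu' _] ms _.
have rneq x y : x != y -> r x <= r y -> r x < r y.
  by rewrite ltn_neqAle => xy ->; rewrite andbT (inj_eq r_inj).
have Aedge x y : x \in A -> y \in A -> x != y -> edge x y.
  by move=> xA yA; have /forall_inP/(_ y yA)/implyP := Ae x xA.
exists (v, w, u).
  rewrite inE /a /= !Aedge -?ms ?inE ?eqxx ?orbT //=.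
  have := rneq _ _ wv' wv; have := rneq _ _ vu' vu; lia.
by apply/setP => x; rewrite -ms !inE /f /= orbA.
Qed.

(** * Stages of the program and their results *)

Lemma bind_time (A B : Type) (m : timed A) (k : A -> timed B) (a b : nat) :
  m.2 <= a -> (k m.1).2 <= b -> (bind m k).2 <= a + b.
Proof. exact: leq_add. Qed.

Lemma sum_seq_const (A : Type) (s : seq A) (c : nat) :
  \sum_(x <- s) c = size s * c.
Proof. by rewrite big_const_seq count_predT iter_addn_0 mulnC. Qed.

Section Program.

Variables (G : sgraph) (X : input G).

Lemma mem_vertices v : v \in vertices X.
Proof. by rewrite (perm_mem (verticesP X)) mem_enum. Qed.

Lemma uniq_vertices : uniq (vertices X).
Proof. by rewrite (perm_uniq (verticesP X)) enum_uniq. Qed.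

Lemma size_vertices : size (vertices X) = #|G|.
Proof. by rewrite (perm_size (verticesP X)) cardE. Qed.

Lemma mem_adjacency v u : (u \in adjacency X v) = edge v u.
Proof. by rewrite (perm_mem (adjacencyP X v)) mem_enum inE. Qed.

Lemma uniq_adjacency v : uniq (adjacency X v).
Proof. by rewrite (perm_uniq (adjacencyP X v)) enum_uniq. Qed.

Lemma size_adjacency v : size (adjacency X v) = deg v.
Proof. by rewrite (perm_size (adjacencyP X v)) -cardE. Qed.

Lemma compute_degrees_result : (compute_degrees X).1 = [ffun v => deg v].
Proof.
rewrite /compute_degrees bind_result foreach_result.
rewrite (eq_foldl (g := fun (a : {ffun G -> nat}) v =>
  [ffun j => if j == v then deg v else a j])) => [|a v]; last first.
  rewrite !bind_result /= foreach_result -size_adjacency; congr finfun.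
  have -> s : foldl (fun st _ => (step st.+1).1) 0 s = size s; last by [].
    rewrite -[RHS]add0n; elim: s 0 => [|x s IHs] m /=.
      by rewrite addn0.
    by rewrite IHs addSnnS.
by rewrite foldl_put; apply/ffunP => v; rewrite !ffunE mem_vertices.
Qed.

(** The order produced by the bucket sort; buckets are reversed because vertices are pushed at their
    front. *)
Definition by_degree : seq G :=
  flatten [seq rev [seq v : G <- vertices X | deg v == d] | d <- iota 0 #|G|.+1].

Lemma deg_le_card (v : G) : deg v <= #|G|.
Proof. exact: max_card. Qed.

Lemma perm_by_degree : perm_eq by_degree (vertices X).
Proof.
apply: perm_bucket; first exact: iota_uniq.
by move=> v _; rewrite mem_iota add0n ltnS deg_le_card.
Qed.

Definition bucket : {ffun 'I_(#|G|).+1 -> seq G} :=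
  [ffun d : 'I_(#|G|).+1 => rev [seq v : G <- vertices X | deg v == d]].

Lemma flatten_bucket :
  flatten [seq bucket d | d <- enum 'I_(#|G|).+1] = by_degree.
Proof.
rewrite /by_degree -val_enum_ord -[in RHS]map_comp; congr flatten.
by apply: eq_map => d; rewrite ffunE.
Qed.

Lemma bucket_result :
  (foreach (vertices X) (new_array 'I_(#|G|).+1 ([::] : seq G)).1
   (fun v bucket =>
    let* d := get (compute_degrees X).1 v in
    let* l := get bucket (inord d) in
    let* l := step (v :: l) in
    put bucket (inord d) l)).1 =
  bucket.
Proof.
rewrite foreach_result compute_degrees_result /=.
rewrite (eq_foldl (g := fun (b : {ffun 'I_(#|G|).+1 -> seq G}) v =>
  [ffun j => if j == inord (deg v) then v :: b (inord (deg v)) else b j])) => [|b v]; last first.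
  by apply/ffunP => j; rewrite /= !ffunE.
apply/ffunP => d; rewrite foldl_push !ffunE cats0 map_id; congr rev.
apply: eq_filter => v; rewrite -val_eqE /= inordK // ltnS; exact: deg_le_card.
Qed.

(** Visiting the buckets in turn is a single pass over their concatenation [by_degree], numbering
    its vertices from 0. *)
Lemma sort_by_degree_result :
  (sort_by_degree X).1 = [ffun v => index v by_degree].
Proof.
rewrite /sort_by_degree !bind_result bucket_result foreach_result.
rewrite (eq_foldl (g := fun st d => foldl (fun (st : {ffun G -> nat} * nat) v =>
    ([ffun j => if j == v then st.2 else st.1 j], st.2.+1)) st (bucket d))) => [|st d]; last first.
  by rewrite bind_result foreach_result; apply: eq_foldl => -[p k] v.
rewrite foldl_flatten.
rewrite flatten_bucket.
have uL : uniq by_degree by rewrite (perm_uniq perm_by_degree) uniq_vertices.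
have := foldl_number [ffun=> 0] 0 uL; rewrite /=.
case: (foldl _ _ _) => p k /= ->; apply/ffunP => v; rewrite !ffunE.
by rewrite (perm_mem perm_by_degree) mem_vertices.
Qed.

(** The arcs of the graph oriented by degree; equal degrees are separated by the position in
    [by_degree]. *)
Definition oriented (w v : G) : bool :=
  edge w v && (index w by_degree < index v by_degree).

(** The nested loops are one fold over the list [arcs] of forward pairs, acting separately on the
    two arrays; one array collects the arcs by tail, the other by head. *)
Lemma build_orientation_result (v : G) :
  perm_eq ((build_orientation X).1.1 v) (enum (oriented v)) /\
  perm_eq ((build_orientation X).1.2 v) (enum (oriented^~ v)).
Proof.
pose fwd (p : G * G) := index p.1 by_degree < index p.2 by_degree.
pose push (o : {ffun G -> seq G}) (a b : G) : {ffun G -> seq G} :=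
  [ffun j => if j == a then b :: o a else o j].
pose f o (p : G * G) := push o p.1 p.2.
pose g o (p : G * G) := push o p.2 p.1.
pose arcs := [seq p <- [seq (w, u) | w <- vertices X, u <- adjacency X w] | fwd p].
have -> : (build_orientation X).1 =
    (foldl f [ffun=> [::]] arcs, foldl g [ffun=> [::]] arcs).
  rewrite /build_orientation bind_result sort_by_degree_result !bind_result foreach_result.
  rewrite (eq_foldl (g := fun st w => foldl (fun st u =>
      if fwd (w, u) then (f st.1 (w, u), g st.2 (w, u)) else st) st (adjacency X w)));
    last first.
    move=> st w; rewrite !bind_result foreach_result.
    apply: eq_foldl => -[o i] u.
    by rewrite !bind_result /= !ffunE /fwd /=; case: ifP.
  rewrite (foldl_allpairs (fun st p => if fwd p then (f st.1 p, g st.2 p) else st)).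
  by rewrite foldl_filter foldl_pair.
have uarcs : uniq arcs.
  apply: filter_uniq; apply: allpairs_uniq_dep; first exact: uniq_vertices.
    by move=> w _; apply: uniq_adjacency.
  by move=> [a b] [c d] _ _ [-> ->].
have marcs w u : ((w, u) \in arcs) = oriented w u.
  rewrite mem_filter /fwd /= /oriented andbC; congr andb.
  apply/allpairsPdep/idP => [[a [b [_ bA [-> ->]]]]|wu].
    by rewrite -mem_adjacency.
  by exists w, u; rewrite mem_vertices mem_adjacency.
clearbody arcs.
split; apply: uniq_perm; rewrite ?enum_uniq //=.
- rewrite foldl_push ffunE cats0 rev_uniq map_inj_in_uniq ?filter_uniq //.
  move=> [a b] [a' b']; rewrite !mem_filter /= => /andP[/eqP -> _] /andP[/eqP -> _].
  by move=> ->.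
- move=> u; rewrite foldl_push ffunE cats0 mem_rev mem_enum -[RHS]marcs.
  apply/mapP/idP => [[[a b]]|vu]; last by exists (v, u); rewrite // mem_filter eqxx.
  by rewrite mem_filter /= => /andP[/eqP <- abA ->].
- rewrite foldl_push ffunE cats0 rev_uniq map_inj_in_uniq ?filter_uniq //.
  move=> [a b] [a' b']; rewrite !mem_filter /= => /andP[/eqP -> _] /andP[/eqP -> _].
  by move=> ->.
- move=> w; rewrite foldl_push ffunE cats0 mem_rev mem_enum -[RHS]marcs.
  apply/mapP/idP => [[[a b]]|wv]; last by exists (w, v); rewrite // mem_filter eqxx.
  by rewrite mem_filter /= => /andP[/eqP <- abA ->].
Qed.

(** The loop invariant is that the Boolean array is constantly [false] between iterations: the
    second pass over [out v] clears exactly the cells set by the first. In between, the array is the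
    characteristic function of [out v]. *)
Lemma count_loop_result (out inn : {ffun G -> seq G}) (c : nat) (s : seq G) :
  foldl (fun st v => ((fun v '(counter, inS) =>
      let* outv := get out v in
      let* inS := foreach outv inS (fun u inS => put inS u true) in
      let* inv := get inn v in
      let* counter := foreach inv counter (fun w counter =>
        let* outw := get out w in
        foreach outw counter (fun u counter =>
          let* b := get inS u in
          if b then step counter.+1 else ret counter)) in
      let* inS := foreach outv inS (fun u inS => put inS u false) in
      ret (counter, inS)) v st).1) (c, [ffun=> false] : {ffun G -> bool}) s =
  (c + \sum_(v <- s) \sum_(w <- inn v) count (mem (out v)) (out w), [ffun=> false]).
Proof.
elim: s c => [|v s IHs] c; first by rewrite big_nil addn0.
rewrite big_cons addnA -IHs; rewrite [LHS]/=; congr foldl.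
rewrite !foreach_result /=; congr pair.
  have -> : foldl (fun (inS : {ffun G -> bool}) u => (put inS u true).1) [ffun=> false] (out v)
     = [ffun j => j \in out v].
    rewrite (foldl_put (fun=> true)); apply/ffunP => j; rewrite !ffunE.
    by case: (j \in _).
  elim: (inn v) c => [|w l IHl] c /=; first by rewrite big_nil addn0.
  rewrite big_cons addnA -IHl; congr foldl.
  rewrite foreach_result /=.
  elim: (out w) c => [|u o IHo] c /=; first by rewrite addn0.
  by rewrite addnA -IHo ffunE /=; case: (u \in _); rewrite /= ?addn1 ?addn0.
rewrite (foldl_put (fun=> true)) (foldl_put (fun=> false)).
apply/ffunP => j; rewrite !ffunE.
by case: (j \in _).
Qed.

Lemma sum_vertices (F : G -> nat) : \sum_(v <- vertices X) F v = \sum_v F v.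
Proof. by rewrite (perm_big _ (verticesP X)) big_enum. Qed.

Lemma index_by_degree_inj : injective (fun v => index v by_degree).
Proof.
move=> u v; apply: (@index_inj _ u by_degree);
  by rewrite (perm_mem perm_by_degree) mem_vertices.
Qed.

(** For each arc from [w] to [v] the loop counts the common out-neighbors of [v] and [w], which is
    the sum of [card_triangles] with the position in [by_degree] as rank. *)
Lemma output_correct : output X = #|triangles G|.
Proof.
rewrite (card_triangles index_by_degree_inj) /output /count_triangles bind_result.
have bo := build_orientation_result.
case: (build_orientation X).1 bo => out inn bo.
rewrite !bind_result foreach_result (count_loop_result out inn 0) /= sum_vertices.
apply: eq_bigr => v _; have [perm_out perm_inn] := bo v.
rewrite (perm_big _ perm_inn) big_enum /=; apply: eq_bigr => w _.
rewrite (permP (bo w).1) -size_filter; set l := filter _ _.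
transitivity #|l|.
  by apply/esym/card_uniqP; rewrite filter_uniq // enum_uniq.
apply: eq_card => u; rewrite mem_filter mem_enum inE /= andbC; congr andb.
by rewrite (perm_mem perm_out) mem_enum.
Qed.

(** * Running time in terms of out-degrees *)

Lemma compute_degrees_time : (compute_degrees X).2 <= 6 * #|G| + 2 * \sum_(v : G) deg v + 2.
Proof.
(* This intermediate sum, like those in the next lemmas, mirrors the code, so that [bind_time] and
   [foreach_time] apply along its structure before it is evaluated in closed form. *)
apply: (@leq_trans (#|G|.+1 +
  (\sum_(v <- vertices X) (1 + (1 + ((\sum_(u <- adjacency X v) 1.+1).+1 + 1))).+1).+1)).
  apply: bind_time => //; apply: foreach_time => v dg.
  do 2!apply: bind_time => //; apply: bind_time => //.
  exact: foreach_time.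
rewrite (eq_bigr (fun v => 5 + 2 * deg v)) => [|v _]; last first.
  by rewrite sum_seq_const size_adjacency; lia.
rewrite big_split /= sum_seq_const size_vertices -big_distrr /= sum_vertices; lia.
Qed.

Lemma sort_by_degree_time :
  (sort_by_degree X).2 <= 19 * #|G| + 2 * \sum_(v : G) deg v + 12.
Proof.
apply: (@leq_trans ((compute_degrees X).2 + ((#|G|.+1).+1 +
  ((\sum_(v <- vertices X) 4.+1).+1 + (#|G|.+1 + (1 +
   ((\sum_(d <- enum 'I_(#|G|).+1) (1 + (\sum_(v <- bucket d) 2.+1).+1).+1).+1
   + 0))))))).
  apply: bind_time => //; apply: bind_time; first by rewrite /= card_ord.
  apply: bind_time; first exact: foreach_time.
  rewrite bucket_result; do 2!apply: bind_time => //.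
  apply: bind_time; last by case: (foreach _ _ _).1.
  apply: foreach_time => d st; apply: bind_time => //.
  by apply: foreach_time => v [].
(* Each bucket costs 3 to visit; together the buckets hold every vertex once, at a cost of 3 per
   vertex. *)
have -> : \sum_(d <- enum 'I_(#|G|).+1) (1 + (\sum_(v <- bucket d) 2.+1).+1).+1 =
    (#|G|).+1 * 3 + #|G| * 3.
  rewrite (eq_bigr (fun d => 3 + \sum_(v <- bucket d) 3)) => [|d _]; last by lia.
  rewrite big_split /= sum_seq_const size_enum_ord; congr addn.
  rewrite -[LHS](big_map bucket xpredT (fun l => \sum_(v <- l) 3)).
  by rewrite -big_flatten flatten_bucket sum_seq_const (perm_size perm_by_degree) size_vertices.
rewrite sum_seq_const size_vertices; have := compute_degrees_time; lia.
Qed.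

Lemma build_orientation_time :
  (build_orientation X).2 <= 26 * #|G| + 11 * \sum_(v : G) deg v + 15.
Proof.
apply: (@leq_trans ((sort_by_degree X).2 + (#|G|.+1 + (#|G|.+1 +
  (\sum_(v <- vertices X) (1 + (1 + (\sum_(u <- adjacency X v) 8.+1).+1)).+1).+1)))).
  do 3!apply: bind_time => //; apply: foreach_time => v st.
  do 2!apply: bind_time => //; apply: foreach_time => u [out inn].
  do 2!apply: (@bind_time _ _ _ _ 1) => //.
  by case: ifP.
have := sort_by_degree_time; move: (sort_by_degree X).2 => T TE.
rewrite (eq_bigr (fun v => 4 + 9 * deg v)) => [|v _]; last first.
  by rewrite sum_seq_const size_adjacency; lia.
rewrite big_split /= sum_seq_const size_vertices -big_distrr /= sum_vertices.
by move: TE; move: (\sum_(v : G) deg v) #|G| => S n TE; lia.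
Qed.

(** Positions are distinct, so the neighbors of [v] split into out-neighbors and in-neighbors, and
    every edge is an out-arc at one end and an in-arc at the other. *)
Lemma sum_deg : \sum_(v : G) deg v = 2 * \sum_v #|oriented v|.
Proof.
rewrite mul2n -addnn; have {2}-> : \sum_v #|oriented v| = \sum_v #|oriented^~ v|.
  under eq_bigr do rewrite -sum1_card.
  under [RHS]eq_bigr do rewrite -sum1_card.
  by rewrite (exchange_big_dep xpredT).
rewrite -big_split /=; apply: eq_bigr => v _.
rewrite /deg cardsE -cardUI [X in _ + X]eq_card0 ?addn0 => [|u]; last first.
  rewrite !inE /= /in_mem /= /oriented; lia.
apply: eq_card => u; rewrite !inE /in_mem /= /oriented [edge u v]edge_sym -andb_orr.
rewrite -neq_ltn (inj_eq index_by_degree_inj).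
by case: eqP => [->|]; rewrite ?andbT // edge_irr.
Qed.

(** Everything but the innermost counting loop is linear in vertices and arcs, and the number of
    arcs is at most the sum of the squared out-degrees. *)
Lemma running_time_le :
  running_time X <= 100 * (#|G|.+1 + \sum_v #|oriented v| ^ 2).
Proof.
rewrite /running_time.
have bo := build_orientation_result.
apply: (@leq_trans ((build_orientation X).2 + (1 + (#|G|.+1 + (
  (\sum_(v <- vertices X) (6 + 4 * #|oriented v| +
     \sum_(w | oriented w v) (3 + 3 * #|oriented w|))).+1
   + 0))))).
  apply: bind_time => //.
  case: (build_orientation X).1 bo => out inn bo.
  do 2!apply: bind_time => //; apply: bind_time; last by case: (foreach _ _ _).1.
  have sout v : size (out v) = #|oriented v| by rewrite (perm_size (bo v).1) -cardE.
  have -> : \sum_(v <- vertices X) (6 + 4 * #|oriented v| +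
      \sum_(w | oriented w v) (3 + 3 * #|oriented w|)) =
    \sum_(v <- vertices X) (1 + ((\sum_(u <- out v) 1.+1).+1 + (1 +
     ((\sum_(w <- inn v) (1 + (\sum_(u <- out w) 2.+1).+1).+1).+1 +
     ((\sum_(u <- out v) 1.+1).+1 + 0))))).+1.
    apply: eq_bigr => v _.
    have <- : \sum_(w <- inn v) (1 + (\sum_(u <- out w) 2.+1).+1).+1 =
        \sum_(w | oriented w v) (3 + 3 * #|oriented w|).
      rewrite (perm_big _ (bo v).2) big_enum /=; apply: eq_bigr => w _.
      by rewrite sum_seq_const sout; lia.
    by rewrite !sum_seq_const sout; move: (\sum_(w <- _) _) #|oriented v| => s k; lia.
  apply: foreach_time => v [counter inS].
  apply: bind_time => //; apply: bind_time; first exact: foreach_time.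
  apply: bind_time => //; apply: bind_time.
    apply: foreach_time => w c; apply: bind_time => //.
    apply: foreach_time => u k; apply: (@bind_time _ _ _ _ 1 1) => //.
    by case: ifP.
  by apply: bind_time => //; apply: foreach_time.
have := build_orientation_time; rewrite sum_deg.
move: (build_orientation X).2 => T TE.
rewrite 2!big_split /= sum_seq_const size_vertices -big_distrr /= !sum_vertices.
(* The list of [w] is scanned once for each out-neighbor of [w]; this is where the squares come
   from. *)
have -> : \sum_v \sum_(w | oriented w v) (3 + 3 * #|oriented w|) =
    3 * \sum_w #|oriented w| + 3 * \sum_w #|oriented w| ^ 2.
  rewrite (exchange_big_dep xpredT) //= !big_distrr -big_split /=.
  apply: eq_bigr => w _.
  transitivity (\sum_(v in oriented w) (3 + 3 * #|oriented w|)); first exact: eq_bigl.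
  by rewrite sum_nat_const; move: #|oriented w| => k; rewrite -mulnn; nia.
have : \sum_v #|oriented v| <= \sum_v #|oriented v| ^ 2.
  by apply: leq_sum => v _; case: #|oriented v| => // k; rewrite expnS leq_pmulr.
move: (\sum_v #|oriented v|) (\sum_v _) #|G| TE => S S2 n; lia.
Qed.

(** A later position in the sorted list [by_degree] means a degree at least as large. *)
Lemma oriented_updeg v : #|oriented v| <= #|[set u | edge v u && (deg v <= deg u)]|.
Proof.
apply: subset_leq_card; apply/subsetP => u; rewrite unfold_in inE.
case/andP=> -> vu /=.
have tr : transitive (relpre (@deg G) leq) by move=> x y z; apply: leq_trans.
have sd : sorted (relpre (@deg G) leq) by_degree by apply: sorted_bucket.
by apply: (sorted_ltn_index tr sd _ _ _ _ vu);
  rewrite (perm_mem perm_by_degree) mem_vertices.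
Qed.

End Program.

(** * Power law sums *)

Local Open Scope ring_scope.

Section Analysis.
Variable R : realType.
Implicit Types (x y s t a : R).

Lemma le_powR_npos x y a : 0 < x -> x <= y -> a <= 0 -> y `^ a <= x `^ a.
Proof.
move=> x0 xy a0; have y0 := lt_le_trans x0 xy.
rewrite -[a]opprK !(powRN _ (- a)) lef_pV2 ?posrE ?powR_gt0 //.
by apply: ge0_ler_powR; rewrite ?nnegrE ?oppr_ge0 // ltW.
Qed.

Lemma le_powR_nneg x y a : 0 <= x -> x <= y -> 0 <= a -> x `^ a <= y `^ a.
Proof.
by move=> x0 xy a0; apply: ge0_ler_powR; rewrite ?nnegrE // (le_trans x0).
Qed.

Lemma powR_ge1 x a : 1 <= x -> 0 <= a -> 1 <= x `^ a.
Proof. by move=> x1 a0; rewrite -(powRr0 x) ler_powR. Qed.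

Lemma powR_gt1 x a : 1 < x -> 0 < a -> 1 < x `^ a.
Proof.
move=> x1 a0; have <- : 1 `^ a = 1 :> R by rewrite powR1.
by apply: gt0_ltr_powR; rewrite ?nnegrE ?(ltW (lt_trans ltr01 x1)).
Qed.

Lemma powR_lt1 x a : 1 < x -> a < 0 -> x `^ a < 1.
Proof.
move=> x1 a0; rewrite -[a]opprK powRN invf_lt1 ?powR_gt1 ?oppr_gt0 //.
by rewrite powR_gt0 // (lt_trans ltr01).
Qed.

(* The telescoping form of the integral bound for [\sum_(i >= k) (i + t)^(-1-s)]. *)
Lemma powR_telescope x s : 1 <= x -> 0 < s ->
  s * 2 `^ (- s - 1) * x `^ (- s - 1) <= x `^ (- s) - (x + 1) `^ (- s).
Proof.
move=> x1 s0; have x0 : 0 < x := lt_le_trans ltr01 x1.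
have y0 : 0 < x + 1 by rewrite addr_gt0.
have step : s * (x + 1) `^ (- s - 1) <= x `^ (- s) - (x + 1) `^ (- s).
  rewrite powRB ?(gt_eqF y0) ?implybT // powRr1 ?(ltW y0) //.
  (* After division by [(x + 1)^(-s)] the claim is [s / (x + 1) <= e^y - 1] with
     [y = s ln((x + 1)/x)]. It follows from [e^y >= 1 + y] and [ln((x + 1)/x) >= 1/(x + 1)]. *)
  have -> : x `^ (- s) = (x + 1) `^ (- s) * (expR (s * ln ((x + 1) / x))).
    rewrite /powR !gt_eqF // -expRD ln_div ?posrE //; congr expR; ring.
  rewrite -[X in _ - X]mulr1 -mulrBr mulrCA ler_wpM2l ?powR_ge0 //.
  rewrite lerBrDl; apply: le_trans (expR_ge1Dx _).
  rewrite lerD2l ler_pM2l //.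
  have : ln (1 + (- (x + 1)^-1)) <= - (x + 1)^-1.
    by apply: le_ln1Dx; rewrite ltrN2 invf_lt1 // ltrDr.
  have -> : 1 + (- (x + 1)^-1) = ((x + 1) / x)^-1.
    by field; rewrite !gt_eqF.
  by rewrite lnV ?posrE ?divr_gt0 // lerN2.
(* As [x >= 1], [x + 1 <= 2 x]; hence the factor [2^(-s-1)]. *)
apply: le_trans step; rewrite -mulrA ler_wpM2l ?(ltW s0) //.
rewrite -powRM ?(ltW x0) //; apply: le_powR_npos => //.
- by rewrite (mulr_natl x 2) mulr2n lerD2l.
- lra.
Qed.

(** Sum of [powR_telescope] at [x = i + t], which is at least 1 because [k > 0]; the negative end
    term is dropped. *)
Lemma sum_powR_le (k n : nat) t s : (0 < k)%N -> 0 <= t -> 0 < s ->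
  \sum_(k <= i < n) (i%:R + t) `^ (- s - 1) <=
    (s * 2 `^ (- s - 1))^-1 * (k%:R + t) `^ (- s).
Proof.
move=> k0 t0 s0.
have c0 : 0 < s * 2 `^ (- s - 1) by rewrite mulr_gt0 // powR_gt0.
rewrite -(ler_pM2l c0) mulrA divff ?gt_eqF // mul1r mulr_sumr.
have [kn|nk] := leqP k n; last first.
  by rewrite big_geq ?powR_ge0 // ltnW.
suff : \sum_(k <= i < n) s * 2 `^ (- s - 1) * (i%:R + t) `^ (- s - 1) <=
   (k%:R + t) `^ (- s) - (n%:R + t) `^ (- s).
  by move/le_trans; apply; rewrite lerBlDr lerDl powR_ge0.
have /= T := telescope_sumr (fun i => (i%:R + t) `^ (- s)) kn.
rewrite -[leRHS]opprB -T -sumrN.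
rewrite big_nat [leRHS]big_nat; apply: ler_sum => i /andP[ki _].
rewrite opprB -[i.+1]addn1 natrD -addrA [1 + t]addrC addrA.
apply: powR_telescope => //.
have : (1 : R) <= i%:R by rewrite ler1n (leq_trans k0).
lra.
Qed.

Lemma sum_geometric_lt (q : R) (D : nat) : 1 < q ->
  \sum_(0 <= d < D) q ^+ d <= (q - 1)^-1 * q ^+ D.
Proof.
move=> q1; have q10 : 0 < q - 1 by rewrite subr_gt0.
rewrite -(ler_pM2l q10) mulrA divff ?gt_eqF // mul1r big_mkord.
by rewrite -subrX1 lerBlDr lerDl.
Qed.

Lemma sum_geometric_ge (q : R) (D e : nat) : 0 < q < 1 ->
  \sum_(D <= d < e) q ^+ d <= (1 - q)^-1 * q ^+ D.
Proof.
case/andP=> q0 q1; have q10 : 0 < 1 - q by rewrite subr_gt0.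
rewrite -(ler_pM2l q10) mulrA divff ?gt_eqF // mul1r.
have [De|eD] := leqP D e; last by rewrite big_geq ?mulr0 ?exprn_ge0 ?(ltW q0) // ltnW.
suff -> : (1 - q) * \sum_(D <= d < e) q ^+ d = q ^+ D - q ^+ e.
  by rewrite lerBlDr lerDl exprn_ge0 // ltW.
have /= T := telescope_sumr (fun i => q ^+ i) De.
rewrite mulr_sumr -[RHS]opprB -T -sumrN.
by apply: eq_bigr => i _; rewrite exprS; ring.
Qed.

Lemma log2_ge0 x : 1 <= x -> 0 <= log2 x.
Proof. by move=> x1; rewrite /log2 divr_ge0 ?ln_ge0 // ler1n. Qed.

Lemma trunc_log_le_log2 (n : nat) : (0 < n)%N -> (trunc_log 2 n)%:R <= log2 n%:R :> R.
Proof.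
move=> n0; have ln2 : 0 < ln 2 :> R by rewrite ln_gt0 // ltr1n.
rewrite /log2 ler_pdivlMr // mulr_natl -lnXn // ler_ln ?posrE ?exprn_gt0 ?ltr0n //.
by rewrite -natrX ler_nat trunc_logP.
Qed.

(** This is [ln y < y] at [y = x^a]. *)
Lemma log2_le_powR x a : 1 <= x -> 0 < a -> log2 x <= (a * ln 2)^-1 * x `^ a.
Proof.
move=> x1 a0; have ln2 : 0 < ln 2 :> R by rewrite ln_gt0 // ltr1n.
have x0 : 0 < x := lt_le_trans ltr01 x1.
rewrite invfM mulrAC /log2 ler_pM2r ?invr_gt0 // ler_pdivlMl // -ln_powR.
by apply: ltW; apply: ln_sublinear; rewrite powR_gt0.
Qed.

(** * Dyadic degree classes of a PLB graph *)

Variables (c1 c2 alpha t : R) (G : sgraph).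
Hypotheses (c1_gt0 : 0 < c1) (c2_gt0 : 0 < c2).
Hypotheses (plb : PLB c1 alpha t G) (nbd : PLB_neighborhoods c1 c2 alpha t G).

Let n : R := #|G|%:R.
Let T : R := t + 1.
Let L : R := log2 n.

Definition updeg (v : G) : nat := #|[set u | edge v u && (deg v <= deg u)%N]|.

Definition degree_class (d : nat) : {set G} :=
  [set v | 2 ^ d <= deg v < 2 ^ d.+1]%N.

Let t_ge0 : 0 <= t. Proof. by case: plb. Qed.
Let alpha_gt2 : 2 < alpha. Proof. by case: nbd. Qed.
Let T_ge1 : 1 <= T. Proof. by rewrite /T lerDr. Qed.
Let n_ge0 : 0 <= n. Proof. exact: ler0n. Qed.

Lemma sum_degree_class (F : G -> R) (D e : nat) :
  \sum_(v | (2 ^ D <= deg v < 2 ^ e)%N) F v =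
  \sum_(D <= d < e) \sum_(v in degree_class d) F v.
Proof.
have [De|eD] := leqP D e; last first.
  rewrite big_geq 1?ltnW // big_pred0 // => v; apply/negP => /andP[Dv ve].
  by have := leq_ltn_trans Dv ve; rewrite ltn_exp2l // ltnNge ltnW.
elim: e De => [|e IHe].
  rewrite leqn0 => /eqP ->; rewrite big_geq // big_pred0 // => v.
  by case: (deg v).
rewrite leq_eqVlt => /orP[/eqP <-|]; last rewrite ltnS => De.
  rewrite big_geq // big_pred0 // => v.
  by apply/negP => /andP[Dv]; rewrite ltnNge Dv.
rewrite big_nat_recr //= -IHe // (bigID (fun v => deg v < 2 ^ e)%N) /=.
congr (_ + _); apply: eq_bigl => v; rewrite ?inE.
- rewrite -andbA; congr andb; rewrite andb_idl // => /leq_trans; apply.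
  by rewrite leq_exp2l.
- rewrite -leqNgt andbC; case: (leqP (2 ^ e) (deg v)) => //= ev.
  by rewrite (leq_trans _ ev) // leq_exp2l.
Qed.

(** The bound in [PLB] has [2^d] summands, each at most the one at [i = 2^d]. *)
Lemma card_degree_class d :
  #|degree_class d|%:R <= c1 * n * T `^ (alpha - 1) * (2 ^+ d * (2 ^+ d + t) `^ (- alpha)).
Proof.
have [_ _ /(_ d)/le_trans] := plb; apply.
rewrite ler_wpM2l ?mulr_ge0 ?powR_ge0 // ?(ltW c1_gt0) //.
have -> : 2 ^+ d * (2 ^+ d + t) `^ (- alpha) =
    \sum_((2 ^ d)%N <= i < (2 ^ d.+1)%N) (2 ^+ d + t) `^ (- alpha).
  rewrite sumr_const_nat expnS mul2n -addnn addnK -natrX mulr_natl //.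
rewrite big_nat [leRHS]big_nat; apply: ler_sum => i /andP[di _].
apply: le_powR_npos; last by have := alpha_gt2; lra.
- by rewrite ltr_wpDr // exprn_gt0.
- by rewrite lerD2r -natrX ler_nat.
Qed.

(** The constant of [sum_powR_le] for [s = alpha - 2]. *)
Definition tail_const : R := ((alpha - 2) * 2 `^ (- (alpha - 2) - 1))^-1.

(** In the bound of [PLB_neighborhoods], the factor [deg v] is at most [2 * 2^d] and [i] is at most
    [i + t]. The remaining tail of [(i + t)^(1 - alpha)] is bounded by [sum_powR_le], and
    [deg v >= 2^d] in the result. *)
Lemma updeg_le d v : v \in degree_class d ->
  (updeg v)%:R <= c2 * Num.max L
    (2 * tail_const * T `^ (alpha - 2) * (2 ^+ d * (2 ^+ d + t) `^ (2 - alpha))).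
Proof.
rewrite inE => /andP[dv vd]; have [_ _ /(_ v)/le_trans] := nbd; apply.
have s0 : 0 < alpha - 2 by rewrite subr_gt0.
have v0 : (0 < deg v)%N by rewrite (leq_trans _ dv) // expn_gt0.
rewrite ler_pM2l // le_max2 // -/T.
have vdR : (deg v)%:R <= 2 * 2 ^+ d :> R.
  by rewrite -exprS -natrX ler_nat ltnW.
have dvR : 2 ^+ d <= (deg v)%:R :> R by rewrite -natrX ler_nat.
have tailE : \sum_(deg v <= i < #|G|) i%:R * (i%:R + t) `^ (- alpha) <=
    tail_const * (2 ^+ d + t) `^ (2 - alpha).
  apply: (@le_trans _ _ (\sum_(deg v <= i < #|G|) (i%:R + t) `^ (- (alpha - 2) - 1))).
    rewrite big_nat [leRHS]big_nat; apply: ler_sum => i /andP[vi _].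
    have i0 : 0 < i%:R :> R by rewrite ltr0n (leq_trans v0).
    have it0 : 0 < i%:R + t by rewrite ltr_wpDr.
    have -> : - (alpha - 2) - 1 = 1 + - alpha by ring.
    rewrite powRD ?(gt_eqF it0) ?implybT // powRr1 ?(ltW it0) //.
    by rewrite ler_wpM2r ?powR_ge0 // lerDl.
  apply: le_trans (sum_powR_le _ v0 t_ge0 s0) _; rewrite -/tail_const opprB.
  have k0 : 0 <= tail_const by rewrite invr_ge0 mulr_ge0 ?powR_ge0 // ltW.
  rewrite ler_wpM2l //; apply: le_powR_npos; last by have := alpha_gt2; lra.
    by rewrite ltr_wpDr // exprn_gt0.
  by rewrite lerD2r.
have -> : 2 * tail_const * T `^ (alpha - 2) * (2 ^+ d * (2 ^+ d + t) `^ (2 - alpha)) =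
   T `^ (alpha - 2) * (2 * 2 ^+ d) * (tail_const * (2 ^+ d + t) `^ (2 - alpha)) by ring.
apply: ler_pM => //.
- by rewrite mulr_ge0 ?powR_ge0.
- by apply: sumr_ge0 => i _; rewrite mulr_ge0 ?powR_ge0.
- by rewrite ler_wpM2l ?powR_ge0.
Qed.

(** The square of [2 * c2 * tail_const] from [updeg_le], times the [c1] of the class size. *)
Definition low_const : R := 4 * c1 * c2 ^+ 2 * tail_const ^+ 2.

Lemma low_const_ge0 : 0 <= low_const.
Proof.
rewrite /low_const -mulrA -exprMn; apply: mulr_ge0; last exact: sqr_ge0.
by rewrite mulr_ge0 // ltW.
Qed.

(** The square of the maximum is at most [L^2 + M^2]. The first part keeps the class size, to be
    summed over all classes; the second is multiplied by [card_degree_class], with exponents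
    [2 (alpha - 2) + (alpha - 1)] for [T] and [2 (2 - alpha) - alpha] for [2^d + t]. *)
Lemma sum_degree_class_updeg d :
  \sum_(v in degree_class d) (updeg v)%:R ^+ 2 <=
    c2 ^+ 2 * L ^+ 2 * #|degree_class d|%:R +
    low_const * n * T `^ (3 * alpha - 5) *
      ((2 ^+ d) ^+ 3 * (2 ^+ d + t) `^ (4 - 3 * alpha)).
Proof.
set x : R := 2 ^+ d; have x0 : 0 < x by rewrite exprn_gt0.
have xt0 : 0 < x + t by rewrite ltr_wpDr.
have T0 : 0 < T by apply: lt_le_trans ltr01 T_ge1.
pose M := 2 * tail_const * T `^ (alpha - 2) * (x * (x + t) `^ (2 - alpha)).
apply: (@le_trans _ _ (\sum_(v in degree_class d) c2 ^+ 2 * (L ^+ 2 + M ^+ 2))).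
  apply: ler_sum => v /updeg_le vM.
  apply: (@le_trans _ _ ((c2 * Num.max L M) ^+ 2)).
    by rewrite lerXn2r // nnegrE ?(le_trans _ vM).
  rewrite exprMn ler_wpM2l ?sqr_ge0 //.
  by rewrite maxEle; case: ifP => _; rewrite (lerDl, lerDr) sqr_ge0.
rewrite sumr_const -[leLHS]mulr_natr [X in X * _ <= _]mulrDr [leLHS]mulrDl lerD2l.
apply: (@le_trans _ _ (c2 ^+ 2 * M ^+ 2 *
   (c1 * n * T `^ (alpha - 1) * (x * (x + t) `^ (- alpha))))).
  by rewrite ler_wpM2l ?card_degree_class // mulr_ge0 ?sqr_ge0.
have -> : T `^ (3 * alpha - 5) = T `^ (alpha - 2) ^+ 2 * T `^ (alpha - 1).
  rewrite expr2 /powR gt_eqF // -!expRD; congr expR; ring.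
have -> : (x + t) `^ (4 - 3 * alpha) = (x + t) `^ (2 - alpha) ^+ 2 * (x + t) `^ (- alpha).
  rewrite expr2 /powR gt_eqF // -!expRD; congr expR; ring.
by rewrite le_eqVlt /M /low_const; apply/orP; left; apply/eqP; ring.
Qed.

Lemma updeg_isolated v : deg v = 0%N -> updeg v = 0%N.
Proof.
move=> v0; apply/eqP; rewrite -leqn0 -v0; apply: subset_leq_card.
by apply/subsetP => u; rewrite !inE => /andP[].
Qed.

(** Degree classes start at degree 1, so isolated vertices are set apart; they contribute 0. The
    sizes of the disjoint classes add up to at most [n]. *)
Lemma sum_updeg_low e :
  \sum_(v | (deg v < 2 ^ e)%N) (updeg v)%:R ^+ 2 <=
    c2 ^+ 2 * L ^+ 2 * n +
    low_const * n * T `^ (3 * alpha - 5) *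
      \sum_(0 <= d < e) ((2 ^+ d) ^+ 3 * (2 ^+ d + t) `^ (4 - 3 * alpha)).
Proof.
rewrite (bigID (fun v => 0 < deg v)%N) /= [X in _ + X]big1 ?addr0; last first.
  by move=> v /andP[_]; rewrite -eqn0Ngt => /eqP/updeg_isolated ->; rewrite expr0n.
rewrite (eq_bigl (fun v => (2 ^ 0 <= deg v < 2 ^ e)%N)) => [|v]; last first.
  by rewrite expn0 andbC.
rewrite sum_degree_class.
apply: le_trans (ler_sum _ (fun d _ => sum_degree_class_updeg d)) _.
rewrite big_split /= -!mulr_sumr lerD2r -exprMn ler_wpM2l ?sqr_ge0 //.
have -> : \sum_(0 <= d < e) #|degree_class d|%:R =
    \sum_(v : G | (2 ^ 0 <= deg v < 2 ^ e)%N) (1 : R).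
  by rewrite sum_degree_class; apply: eq_bigr => d _; rewrite sumr_const.
by rewrite sumr_const ler_nat max_card.
Qed.

(** The exponent [7 - 3 alpha] is nonpositive, so every class term is at most [T^(7 - 3 alpha)], and
    there are at most [1 + L] classes. With the factor [T^(3 alpha - 5)] this gives [T^2]. *)
Lemma sum_updeg_log : 7 / 3 <= alpha -> (0 < #|G|)%N ->
  \sum_(v : G) (updeg v)%:R ^+ 2 <=
    (c2 ^+ 2 + low_const) * (1 + L) ^+ 2 * (n * T ^+ 2).
Proof.
move=> alpha73 G0; have L0 : 0 <= L by rewrite log2_ge0 // ler1n.
have T0 : 0 < T := lt_le_trans ltr01 T_ge1.
have bc0 := low_const_ge0.
(* Every degree is at most [#|G| < 2^e], so all vertices count as low. *)
pose e := (trunc_log 2 #|G|).+1.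
rewrite (eq_bigl (fun v : G => deg v < 2 ^ e)%N) => [|v]; last first.
  by rewrite (leq_ltn_trans (max_card _)) // trunc_log_ltn.
apply: le_trans (sum_updeg_low e) _.
have term d : (2 ^+ d) ^+ 3 * (2 ^+ d + t) `^ (4 - 3 * alpha) <= T `^ (7 - 3 * alpha).
  set x : R := 2 ^+ d; have x1 : 1 <= x by rewrite exprn_ege1 // ler1n.
  have xt0 : 0 < x + t by rewrite ltr_wpDr // (lt_le_trans ltr01).
  apply: (@le_trans _ _ ((x + t) `^ (7 - 3 * alpha))).
    have -> : 7 - 3 * alpha = 3%:R + (4 - 3 * alpha) by ring.
    rewrite (@powRD _ _ 3%:R) ?(gt_eqF xt0) ?implybT // powR_mulrn ?(ltW xt0) //.
    rewrite ler_wpM2r ?powR_ge0 // lerXn2r ?nnegrE ?(ltW xt0) ?lerDl //.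
    exact: le_trans ler01 x1.
  apply: le_powR_npos => //; last by lra.
  by rewrite /T [x + t]addrC lerD2l.
have sumL : \sum_(0 <= d < e) ((2 ^+ d) ^+ 3 * (2 ^+ d + t) `^ (4 - 3 * alpha)) <=
    (1 + L) * T `^ (7 - 3 * alpha).
  apply: le_trans (ler_sum _ (fun d _ => term d)) _.
  rewrite sumr_const_nat subn0 -(mulr_natl (T `^ _)) ler_wpM2r ?powR_ge0 //.
  by rewrite /e -[X in X%:R]addn1 natrD addrC lerD2l trunc_log_le_log2.
apply: (@le_trans _ _ (c2 ^+ 2 * L ^+ 2 * n + low_const * n * T ^+ 2 * (1 + L))).
  rewrite lerD2l.
  have -> : low_const * n * T ^+ 2 * (1 + L) =
      low_const * n * T `^ (3 * alpha - 5) * ((1 + L) * T `^ (7 - 3 * alpha)).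
    have -> : T ^+ 2 = T `^ (3 * alpha - 5) * T `^ (7 - 3 * alpha).
      rewrite -powR_mulrn ?(ltW T0) // /powR gt_eqF // -expRD; congr expR; ring.
    ring.
  by rewrite ler_wpM2l // mulr_ge0 ?powR_ge0 // mulr_ge0.
have -> : (c2 ^+ 2 + low_const) * (1 + L) ^+ 2 * (n * T ^+ 2) =
    c2 ^+ 2 * ((1 + L) ^+ 2 * (n * T ^+ 2)) +
    low_const * (n * (T ^+ 2 * (1 + L) ^+ 2)) by ring.
have -> : c2 ^+ 2 * L ^+ 2 * n + low_const * n * T ^+ 2 * (1 + L) =
    c2 ^+ 2 * (L ^+ 2 * n) + low_const * (n * (T ^+ 2 * (1 + L))) by ring.
apply: lerD.
  apply: ler_wpM2l; first exact: sqr_ge0.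
  apply: ler_pM; rewrite ?sqr_ge0 //.
    by rewrite lerXn2r ?nnegrE ?addr_ge0 ?lerDr.
  by rewrite ler_peMr // exprn_ege1.
do 2!apply: ler_wpM2l => //; apply: ler_wpM2l; first exact: sqr_ge0.
by rewrite expr2 ler_peMr ?addr_ge0 // lerDl.
Qed.

(** For the number of vertices of degree at least [2^D]: a geometric sum of ratio [2^(1 - alpha)],
    and the loss from [2^D >= K / 2]. *)
Definition high_const : R := c1 * (1 - 2 `^ (1 - alpha))^-1 * 2 `^ (alpha - 1).

(* With [K = sqrt (n * (t + 1))], vertices of degree below [K] are handled by
   the neighborhood bound, and there are few enough others that their number
   bounds their [updeg]. *)
Lemma sum_updeg_power : alpha < 7 / 3 -> (0 < #|G|)%N ->
  \sum_(v : G) (updeg v)%:R ^+ 2 <=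
    (c2 ^+ 2 * (((7 / 2 - 3 * alpha / 2) / 2 * ln 2)^-1) ^+ 2 +
     low_const * (2 `^ (7 - 3 * alpha) - 1)^-1 + high_const ^+ 3) *
    (n `^ (9 / 2 - 3 * alpha / 2) * T `^ (3 * alpha / 2 - 3 / 2)).
Proof.
move=> alpha73 G0.
have g0 : 0 < (7 / 2 - 3 * alpha / 2) / 2 by lra.
have e0 : 0 <= 3 * alpha / 2 - 3 / 2 by have := alpha_gt2; lra.
have e1 : 0 < 7 - 3 * alpha by lra.
have e2 : 4 - 3 * alpha <= 0 by have := alpha_gt2; lra.
have e3 : 1 - alpha < 0 by have := alpha_gt2; lra.
have e4 : - alpha <= 0 by have := alpha_gt2; lra.
have n1 : 1 <= n by rewrite ler1n.
have n0 : 0 < n := lt_le_trans ltr01 n1.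
have T0 : 0 < T := lt_le_trans ltr01 T_ge1.
have L0 : 0 <= L by rewrite log2_ge0.
have bc0 := low_const_ge0.
pose K := (n * T) `^ (1 / 2).
have K1 : 1 <= K by rewrite powR_ge1 ?divr_ge0 // -[X in X <= _]mulr1 ler_pM.
have K0 : 0 < K := lt_le_trans ltr01 K1.
have nT0 : 0 < n * T by rewrite mulr_gt0.
have lnT : ln (n * T) = ln n + ln T by rewrite lnM ?posrE.
have powD (x a b : R) : 0 < x -> x `^ (a + b) = x `^ a * x `^ b.
  by move=> x0; rewrite powRD // (gt_eqF x0) implybT.
(* The threshold [K] is rounded down to a power of two, so that the split falls between degree
   classes. *)
pose D := trunc_log 2 (Num.truncn K).
have [DK KD] : 2 ^+ D <= K /\ K <= 2 * 2 ^+ D.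
  have /andP[kK Kk] := truncn_itv (ltW K0).
  have k0 : (0 < Num.truncn K)%N by rewrite -ltnS -(ltr_nat R) (le_lt_trans K1).
  have /andP[lo hi] := trunc_log_bounds (isT : 1 < 2)%N k0.
  split; first by apply: le_trans kK; rewrite -natrX ler_nat.
  by apply: (le_trans (ltW Kk)); rewrite -exprS -natrX ler_nat.
clearbody D.
have x_gt0 d : 0 < 2 ^+ d :> R by rewrite exprn_gt0.
have pow2 d (a : R) : (2 ^+ d) `^ a = (2 `^ a) ^+ d.
  by rewrite -(powR_mulrn d (ler0n R 2)) -(powR_mulrn d (powR_ge0 2 a)) powRAC.
set W := n `^ _ * T `^ _.
(* The three constants serve the logarithmic part, the classes below [2^D] and the vertices of
   degree at least [2^D], in this order. *)
rewrite (bigID (fun v => deg v < 2 ^ D)%N) /= [X in _ <= X]mulrDl; apply: lerD.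
  apply: le_trans (sum_updeg_low D) _; rewrite [leRHS]mulrDl; apply: lerD.
    (* Here [L = O(n^g)] with [2 g + 1 = 9/2 - 3 alpha/2], and the power of [T] in [W] is at least
       1. *)
    have := log2_le_powR n1 g0; rewrite -/L; set g := _ / 2; set c := (_ * _)^-1 => Lc.
    apply: (@le_trans _ _ (c2 ^+ 2 * (c * n `^ g) ^+ 2 * n)).
      rewrite ler_wpM2r // ler_wpM2l ?sqr_ge0 // lerXn2r ?nnegrE //.
      exact: le_trans Lc.
    have -> : c2 ^+ 2 * (c * n `^ g) ^+ 2 * n = c2 ^+ 2 * c ^+ 2 * (n `^ g ^+ 2 * n) by ring.
    apply: ler_wpM2l; first by rewrite -exprMn sqr_ge0.
    have -> : n `^ g ^+ 2 * n = n `^ (9 / 2 - 3 * alpha / 2).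
      by rewrite -[X in _ * X](powRr1 n_ge0) expr2 -!powD // /g; congr powR; field.
    by rewrite /W ler_peMr ?powR_ge0 // powR_ge1.
  (* Dropping [t] from [2^d + t] leaves a geometric sum whose ratio exceeds 1 as [alpha < 7/3]; it
     is [O(K^(7 - 3 alpha))]. *)
  have q1 : 1 < 2 `^ (7 - 3 * alpha) :> R.
    by rewrite powR_gt1 ?ltr1n.
  apply: (@le_trans _ _ (low_const * n * T `^ (3 * alpha - 5) *
      ((2 `^ (7 - 3 * alpha) - 1)^-1 * K `^ (7 - 3 * alpha)))).
    apply: ler_wpM2l; first by apply: mulr_ge0; [apply: mulr_ge0 | apply: powR_ge0].
    apply: (@le_trans _ _ (\sum_(0 <= d < D) (2 `^ (7 - 3 * alpha)) ^+ d)).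
      apply: ler_sum => d _; rewrite -pow2.
      have -> : 7 - 3 * alpha = 3%:R + (4 - 3 * alpha) by ring.
      rewrite (powD _ 3%:R) // powR_mulrn ?(ltW (x_gt0 d)) // ler_wpM2l ?exprn_ge0 ?(ltW (x_gt0 d)) //.
      by apply: le_powR_npos => //; rewrite lerDl.
    apply: le_trans (sum_geometric_lt _ q1) _.
    rewrite ler_wpM2l ?invr_ge0 ?subr_ge0 ?(ltW q1) // -pow2.
    by apply: le_powR_nneg => //; apply: ltW.
  rewrite le_eqVlt; apply/orP; left; apply/eqP.
  (* By [K^2 = n T], the exponents are [1 + (7 - 3 alpha)/2] for [n] and
     [3 alpha - 5 + (7 - 3 alpha)/2] for [T]. *)
  have -> : W = n * T `^ (3 * alpha - 5) * K `^ (7 - 3 * alpha).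
    rewrite /W /K -powRrM -[X in _ = X * _ * _](powRr1 n_ge0) /powR !gt_eqF // lnT -!expRD.
    by congr expR; field.
  ring.
pose N := #|[set v : G | (2 ^ D <= deg v)%N]|.
(* The class sizes from [D] on decrease geometrically, so the bound for the first class
   dominates. *)
have NK : N%:R <= high_const * (n * T `^ (alpha - 1) * K `^ (1 - alpha)).
  have q1 : 0 < (2 : R) `^ (1 - alpha) < 1.
    by rewrite powR_gt0 // powR_lt1 ?ltr1n.
  pose e := (trunc_log 2 #|G|).+1.
  have -> : N%:R = \sum_(v : G | (2 ^ D <= deg v < 2 ^ e)%N) (1 : R).
    rewrite sumr_const -cardsE; congr (_ %:R); apply: eq_card => v.
    by rewrite !inE /in_mem /= (leq_ltn_trans (max_card _)) ?andbT // trunc_log_ltn.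
  rewrite sum_degree_class.
  apply: (@le_trans _ _ (\sum_(D <= d < e) c1 * n * T `^ (alpha - 1) * (2 `^ (1 - alpha)) ^+ d)).
    apply: ler_sum => d _; rewrite sumr_const; apply: le_trans (card_degree_class d) _.
    rewrite ler_wpM2l ?mulr_ge0 ?powR_ge0 ?(ltW c1_gt0) // -pow2 powD //.
    rewrite powRr1 ?(ltW (x_gt0 d)) // ler_wpM2l ?(ltW (x_gt0 d)) //.
    by apply: le_powR_npos; rewrite ?lerDl.
  rewrite -mulr_sumr /high_const.
  have -> : c1 * (1 - 2 `^ (1 - alpha))^-1 * 2 `^ (alpha - 1) *
      (n * T `^ (alpha - 1) * K `^ (1 - alpha)) =
    c1 * n * T `^ (alpha - 1) *
      ((1 - 2 `^ (1 - alpha))^-1 * (2 `^ (alpha - 1) * K `^ (1 - alpha))) by ring.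
  rewrite ler_wpM2l ?mulr_ge0 ?powR_ge0 ?(ltW c1_gt0) //.
  apply: le_trans (sum_geometric_ge _ _ q1) _.
  case/andP: q1 => _ q1; rewrite ler_wpM2l ?invr_ge0 ?subr_ge0 ?(ltW q1) // -pow2.
  have -> : 2 `^ (alpha - 1) * K `^ (1 - alpha) = (K / 2) `^ (1 - alpha).
    rewrite powRM ?(ltW K0) ?invr_ge0 ?ler0n // mulrC; congr (_ * _).
    by rewrite -powR_inv1 // -powRrM; congr powR; ring.
  apply: le_powR_npos; [by rewrite divr_gt0 | by rewrite ler_pdivrMr // mulrC |].
  exact: ltW.
(* Neighbors counted by [updeg v] have degree at least [deg v >= 2^D], so each of the [N] terms is
   at most [N^2]. *)
apply: (@le_trans _ _ (N%:R ^+ 3)).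
  apply: (@le_trans _ _ (\sum_(v : G | ~~ (deg v < 2 ^ D)%N) N%:R ^+ 2)).
    apply: ler_sum => v; rewrite -leqNgt => Dv; rewrite lerXn2r ?nnegrE // ler_nat.
    apply: subset_leq_card; apply/subsetP => u; rewrite !inE => /andP[_].
    exact: leq_trans.
  rewrite sumr_const -(mulr_natl (_ ^+ 2)) [X in _ <= X]exprS ler_wpM2r ?sqr_ge0 // ler_nat.
  by rewrite subset_leq_card //; apply/subsetP => v; rewrite !inE /in_mem /= -leqNgt.
(* The choice of [K] makes both ranges agree: [3 (1 + (1 - alpha)/2) = 9/2 - 3 alpha/2], and [T]
   gets [3 (alpha - 1)/2]. *)
have -> : W = (n * T `^ (alpha - 1) * K `^ (1 - alpha)) ^+ 3.
  rewrite /W /K -powRrM -[X in _ = (X * _ * _) ^+ 3](powRr1 n_ge0) /powR !gt_eqF // lnT !exprS expr0 mulr1.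
  by rewrite -!expRD; congr expR; field.
rewrite -exprMn lerXn2r // nnegrE; first exact: ler0n.
by apply: le_trans NK; apply: ler0n.
Qed.

End Analysis.

(** * The final time bounds *)

(** For a nonempty graph [#|G|.+1 <= 2 * #|G|], and [oriented_updeg] replaces out-degrees by
    [updeg]. *)
Lemma running_time_updeg (R : realType) (G : sgraph) (X : input G) : (0 < #|G|)%N ->
  (running_time X)%:R <=
    100 * (2 * #|G|%:R + \sum_(v : G) (updeg v)%:R ^+ 2) :> R.
Proof.
move=> G0; have -> : 100 * (2 * #|G|%:R + \sum_(v : G) (updeg v)%:R ^+ 2) =
    (100 * (2 * #|G| + \sum_(v : G) updeg v ^ 2))%:R :> R.
  rewrite natrM natrD natrM natr_sum; congr (_ * (_ + _)).
  by apply: eq_bigr => v _; rewrite natrX.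
rewrite ler_nat (leq_trans (running_time_le X)) // leq_mul2l /= leq_add //.
  by rewrite mul2n -addnn -addn1 leq_add2l.
by apply: leq_sum => v _; rewrite leq_exp2r // oriented_updeg.
Qed.

Theorem theorem5p6 (R : realType) (c1 c2 alpha : R)
    (c1_gt0 : 0 < c1) (c2_gt0 : 0 < c2) (alpha_lt3 : alpha < 3) :
  exists (C : R) (k : nat),
    forall (G : sgraph) (t : R) (X : input G),
      PLB c1 alpha t G -> PLB_neighborhoods c1 c2 alpha t G ->
      output X = #|triangles G| /\
      ((0 < #|G|)%N ->
        (2 < alpha < 7 / 3 ->
          (running_time X)%:R <=
            C * (#|G|%:R `^ (9 / 2 - 3 * alpha / 2) *
                 (t + 1) `^ (3 * alpha / 2 - 3 / 2))) /\
        (7 / 3 <= alpha ->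
          (running_time X)%:R <=
            C * (1 + log2 #|G|%:R) ^+ k * (#|G|%:R * (t + 1) ^+ 2))).
Proof.
(* The range of [alpha] is settled before [C] and [k] are chosen, so that neither depends on the
   graph or on [t]. Unification fills the open part of [C] with the constant of the bound on the sum
   of squares. *)
have [alpha73|alpha73] := ltP alpha (7 / 3).
  eexists (100 * (2 + _)), 0 => G t X plb nbd; split; first exact: output_correct.
  move=> G0; split=> [/andP[alpha2 _]|//].
  apply: le_trans (running_time_updeg R X G0) _.
  have [_ t0 _] := plb; have n1 : 1 <= #|G|%:R :> R by rewrite ler1n.
  rewrite -mulrA ler_wpM2l // [leRHS]mulrDl.
  apply: lerD; last exact: (sum_updeg_power c1_gt0 c2_gt0 plb nbd alpha73 G0).
  rewrite ler_wpM2l //.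
  (* The linear term is absorbed, since [9/2 - 3 alpha/2 >= 1] when [alpha < 7/3]. *)
  apply: (@le_trans _ _ (#|G|%:R `^ (9 / 2 - 3 * alpha / 2))).
    by apply: le1r_powR => //; lra.
  by rewrite ler_peMr ?powR_ge0 // powR_ge1 ?lerDr //; lra.
eexists (100 * (2 + _)), 2 => G t X plb nbd; split; first exact: output_correct.
move=> G0; split=> [|_]; first by rewrite andbF.
apply: le_trans (running_time_updeg R X G0) _.
have [_ t0 _] := plb; have n1 : 1 <= #|G|%:R :> R by rewrite ler1n.
have L0 : 0 <= log2 (#|G|%:R : R) by apply: log2_ge0.
rewrite -!(mulrA 100) ler_wpM2l // [X in _ <= X * _]mulrDl [leRHS]mulrDl.
apply: lerD; last exact: (sum_updeg_log c1_gt0 c2_gt0 plb nbd alpha73 G0).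
rewrite -mulrA ler_wpM2l //.
apply: (@le_trans _ _ (#|G|%:R * (t + 1) ^+ 2)).
  by rewrite ler_peMr // exprn_ege1 // lerDr.
by rewrite ler_peMl ?exprn_ege1 ?lerDl // mulr_ge0 // sqr_ge0.
Qed.
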